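(* Let $V$ be a Gödel set which is finite or uncountable. Let $A$ be a prenex formula and let $\exists\bar x\,B^F(\bar x)$ be its Herbrand form. Then $A$ is valid in $\mathbf{G}_V$ if and only if there are tuples $\bar t_1,\dots,\bar t_m$ of terms in the Herbrand universe $\mathrm{HU}(B^F)$ such that $\bigvee_{i=1}^m B^F(\bar t_i)$ is valid in $\mathbf{G}_V$.
   Context: Fix a standard first-order language with connectives $\wedge,\vee,\rightarrow$, constant $\bot$, quantifiers $\forall,\exists$. A Gödel set is a closed $V\subseteq[0,1]$ with $0,1\in V$. A $V$-interpretation $\mathfrak I$ has a nonempty universe $U$, assigns to each $k$-ary predicate symbol a function $U^k\to V$, to each $k$-ary function symbol a function $U^k\to U$, and to each variable an element of $U$; truth values are: atomic formulas get the value of the predicate function on the term values, $\bot\mapsto 0$, $\wedge\mapsto\min$, $\vee\mapsto\max$, $\mathfrak I(A\rightarrow B)=1$ if $\mathfrak I(A)\le\mathfrak I(B)$ and $\mathfrak I(B)$ otherwise, $\forall\mapsto\inf$ and $\exists\mapsto\sup$ of the values of the instances $A(u)$, $u\in U$. A formula is valid in $\mathbf{G}_V$ if it gets value $1$ under every $V$-interpretation. Herbrand form: for a prenex $A\equiv Q_1x_1\dots Q_nx_nB(x_1,\dots,x_n)$ with $B$ quantifier-free, let $x_{i_1},\dots,x_{i_m}$ ($i_1<\dots<i_m$) be the existentially quantified variables. The Herbrand form is $\exists x_{i_1}\dots\exists x_{i_m}B(t_1,\dots,t_n)$ where $t_i=x_i$ if $x_i$ is existentially quantified, and $t_i=f_i(x_{i_1},\dots,x_{i_k})$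 with $f_i$ a new function symbol and $k=\max\{j:i_j<i\}$ if $x_i$ is universally quantified; $B(t_1,\dots,t_n)$ is written $B^F(x_{i_1},\dots,x_{i_m})$. The Herbrand universe $\mathrm{HU}(B^F)$ is the set of variable-free terms built from the function symbols occurring in $B^F$, where a constant and a function symbol of positive arity are added if no such symbols occur in $B^F$. *)

(* Defs.v *)
From HB Require Import structures.
From mathcomp Require Import all_boot all_order all_algebra.
From mathcomp Require Import all_classical all_reals all_analysis.

Set Implicit Arguments.
Unset Strict Implicit.
Unset Printing Implicit Defensive.

Import Order.TTheory GRing.Theory Num.Theory.
Import numFieldNormedType.Exports.

Local Open Scope classical_set_scope.
Local Open Scope ring_scope.

(** * Syntax *)

Record language := Language {
  fun_sym : Type; fun_ar : fun_sym -> nat;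
  pred_sym : Type; pred_ar : pred_sym -> nat }.

(** Terms and formulas are well scoped: those of index [n] have their free
    variables among [x_0, ..., x_(n-1)], and a quantifier over a formula of
    index [n.+1] binds its last variable [x_n].  Hence [term L 0] is the type of
    variable-free terms and [formula L 0] the type of closed formulas. *)
Inductive term (L : language) (n : nat) : Type :=
| Var of 'I_n
| App (f : fun_sym L) of ('I_(fun_ar f) -> term L n).

Inductive formula (L : language) : nat -> Type :=
| Bot n : formula L n
| Atom n (p : pred_sym L) : ('I_(pred_ar p) -> term L n) -> formula L n
| And n : formula L n -> formula L n -> formula L n
| Or n : formula L n -> formula L n -> formula L n
| Imp n : formula L n -> formula L n -> formula L n
| All n : formula L n.+1 -> formula L n
| Ex n : formula L n.+1 -> formula L n.

Arguments Var {L n}.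
Arguments App {L n}.
Arguments Bot {L n}.
Arguments Atom {L n}.

Fixpoint qfree L n (A : formula L n) : bool :=
  match A with
  | Bot _ | Atom _ _ _ => true
  | And _ A B | Or _ A B | Imp _ A B => qfree A && qfree B
  | All _ _ | Ex _ _ => false
  end.

(** The value for the empty list is immaterial: [Bot] is never valid. *)
Fixpoint bigor L n (s : seq (formula L n)) : formula L n :=
  match s with
  | [::] => Bot
  | [:: A] => A
  | A :: s' => Or A (bigor s')
  end.

Fixpoint occurs_t L n (f : fun_sym L) (t : term L n) : Prop :=
  match t with
  | Var _ => False
  | App g a => g = f \/ exists i, occurs_t f (a i)
  end.

Fixpoint occurs L n (f : fun_sym L) (A : formula L n) : Prop :=
  match A with
  | Bot _ => False
  | Atom _ _ a => exists i, occurs_t f (a i)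
  | And _ A B | Or _ A B | Imp _ A B => occurs f A \/ occurs f B
  | All _ A | Ex _ A => occurs f A
  end.

(** [extend s u] is [s] followed by [u]. *)
Definition extend (T : Type) n (s : 'I_n -> T) (u : T) (i : 'I_n.+1) : T :=
  if unlift ord_max i is Some j then s j else u.

Fixpoint subst_t L n k (sigma : 'I_n -> term L k) (t : term L n) : term L k :=
  match t with
  | Var i => sigma i
  | App f a => App f (fun i => subst_t sigma (a i))
  end.

Definition weaken L n : term L n -> term L n.+1 :=
  subst_t (fun i => Var (lift ord_max i)).

Definition up L n k (sigma : 'I_n -> term L k) : 'I_n.+1 -> term L k.+1 :=
  extend (fun i => weaken (sigma i)) (Var ord_max).

Fixpoint subst L n (A : formula L n) :
    forall k, ('I_n -> term L k) -> formula L k :=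
  match A in formula _ n return forall k, ('I_n -> term L k) -> formula L k with
  | Bot _ => fun k _ => Bot
  | Atom _ p a => fun k sigma => Atom p (fun i => subst_t sigma (a i))
  | And _ A B => fun k sigma => And (subst A sigma) (subst B sigma)
  | Or _ A B => fun k sigma => Or (subst A sigma) (subst B sigma)
  | Imp _ A B => fun k sigma => Imp (subst A sigma) (subst B sigma)
  | All _ A => fun k sigma => All (subst A (up sigma))
  | Ex _ A => fun k sigma => Ex (subst A (up sigma))
  end.

(** * Semantics *)

Definition goedel_set (R : realType) (V : set R) : Prop :=
  [/\ closed V, V `<=` `[0, 1], V 0 & V 1].

Record interp (R : realType) (V : set R) (L : language) := Interp {
  univ : Type;
  univ_nonempty : inhabited univ;
  fint : forall f : fun_sym L, ('I_(fun_ar f) -> univ) -> univ;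
  pint : forall p : pred_sym L, ('I_(pred_ar p) -> univ) -> R;
  pint_V : forall (p : pred_sym L) a, V (@pint p a) }.

(** The assignment of elements to the variables is kept apart from the rest of
    the interpretation; validity quantifies over both. *)
Fixpoint term_val (R : realType) (V : set R) L (I : interp V L) n
    (s : 'I_n -> univ I) (t : term L n) : univ I :=
  match t with
  | Var i => s i
  | App f a => fint (fun i => term_val s (a i))
  end.

Fixpoint truth_val (R : realType) (V : set R) L (I : interp V L) n
    (A : formula L n) : ('I_n -> univ I) -> R :=
  match A in formula _ n return ('I_n -> univ I) -> R with
  | Bot _ => fun _ => 0
  | Atom _ p a => fun s => pint (fun i => term_val s (a i))
  | And _ A B => fun s => Num.min (truth_val A s) (truth_val B s)
  | Or _ A B => fun s => Num.max (truth_val A s) (truth_val B s)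
  | Imp _ A B => fun s =>
      if truth_val A s <= truth_val B s then 1 else truth_val B s
  | All _ A => fun s => inf (range (fun u => truth_val A (extend s u)))
  | Ex _ A => fun s => sup (range (fun u => truth_val A (extend s u)))
  end.

Definition valid (R : realType) (V : set R) L n (A : formula L n) : Prop :=
  forall (I : interp V L) (s : 'I_n -> univ I), truth_val A s = 1.

(** * Prenex formulas and Herbrand forms *)

Inductive quantifier := Forall | Exists.

Definition is_ex (q : quantifier) : bool := if q is Exists then true else false.

Definition quantify L n (q : quantifier) (A : formula L n.+1) : formula L n :=
  match q with Forall => All A | Exists => Ex A end.

(** [prenex Q B] is [Q_0 x_0 ... Q_(n-1) x_(n-1) B]. *)
Fixpoint prenex L n : ('I_n -> quantifier) -> formula L n -> formula L 0 :=
  match n return ('I_n -> quantifier) -> formula L n -> formula L 0 with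
  | 0 => fun _ B => B
  | n'.+1 => fun Q B =>
      prenex (fun i => Q (lift ord_max i)) (quantify (Q ord_max) B)
  end.

Section Herbrand.
Context (L : language) (n : nat) (Q : 'I_n -> quantifier).

Definition exvars : {set 'I_n} := [set i | is_ex (Q i)].

(** The number of existential variables preceding [x_i]: the arity of the
    Skolem symbol of [x_i] if [x_i] is universal, and the position of [x_i]
    (from 0) in the list of existential variables if [x_i] is existential. *)
Definition exrank (i : 'I_n) : nat := #|[set j in exvars | (j < i)%N]|.

Lemma exrank_le i : (exrank i <= #|exvars|)%N.
Proof. by apply/subset_leq_card/fintype.subsetP => j; rewrite inE => /andP[]. Qed.

Lemma exrank_lt i : i \in exvars -> (exrank i < #|exvars|)%N.
Proof.
move=> iE; apply/proper_card/properP; split.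
  by apply/fintype.subsetP => j; rewrite inE => /andP[].
by exists i => //; rewrite inE ltnn andbF.
Qed.

(** [HConst] and [HFun] are the constant and the function symbol of positive
    arity that may have to be added in order to form the Herbrand universe. *)
Inductive hfsym : Type :=
| Orig of fun_sym L
| Skolem of 'I_n
| HConst
| HFun.

Definition hfar (f : hfsym) : nat :=
  match f with
  | Orig f => fun_ar f
  | Skolem i => exrank i
  | HConst => 0
  | HFun => 1
  end.

Definition hlang : language := Language hfar (@pred_ar L).

Fixpoint emb_t k (t : term L k) : term hlang k :=
  match t with
  | Var i => Var i
  | App f a => @App hlang k (Orig f) (fun i => emb_t (a i))
  end.

Fixpoint emb k (A : formula L k) : formula hlang k :=
  match A in formula _ k return formula hlang k with
  | Bot _ => Bot
  | Atom _ p a => @Atom hlang _ p (fun i => emb_t (a i))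
  | And _ A B => And (emb A) (emb B)
  | Or _ A B => Or (emb A) (emb B)
  | Imp _ A B => Imp (emb A) (emb B)
  | All _ A => All (emb A)
  | Ex _ A => Ex (emb A)
  end.

(** The variables of the Herbrand form are the existential variables of the
    prefix, renumbered in order from 0. *)
Definition hterm (i : 'I_n) : term hlang #|exvars| :=
  match boolP (i \in exvars) with
  | AltTrue iE => Var (Ordinal (exrank_lt iE))
  | AltFalse _ =>
      @App hlang _ (Skolem i) (fun l => Var (widen_ord (exrank_le i) l))
  end.

(** The matrix [B^F] of the Herbrand form; the Herbrand form itself is
    [prenex (fun=> Exists) (herbrand_matrix B)]. *)
Definition herbrand_matrix (B : formula L n) : formula hlang #|exvars| :=
  subst (emb B) hterm.

(** The last two cases are independent of each other, so that the Herbrand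
    universe is always infinite. *)
Definition HUsym k (C : formula hlang k) (f : fun_sym hlang) : Prop :=
  [\/ occurs f C,
      f = HConst /\ ~ (exists2 g : fun_sym hlang, occurs g C & fun_ar g = 0%N) |
      f = HFun /\ ~ (exists2 g : fun_sym hlang, occurs g C & (0 < fun_ar g)%N)].

Definition HU k (C : formula hlang k) : set (term hlang 0) :=
  [set t | forall f : fun_sym hlang, occurs_t f t -> HUsym C f].

End Herbrand.

(* Main.v *)
Require Import Defs.
From HB Require Import structures.
From mathcomp Require Import all_boot all_order all_algebra.
From mathcomp Require Import all_classical all_reals all_analysis.

Set Implicit Arguments.
Unset Strict Implicit.
Unset Printing Implicit Defensive.

Import Order.TTheory GRing.Theory Num.Theory.
Import numFieldNormedType.Exports.

Local Open Scope classical_set_scope.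
Local Open Scope ring_scope.

(** The universal player's choices in a refutation of the prenex formula [A] are
    Skolem functions making every instance [B^F(x)] smaller than 1, and this
    refutes every finite disjunction of instances.  Conversely, if no finite
    disjunction is valid, enumerate the tuples of Herbrand terms, let [I_N]
    refute the first [N] instances, and take the ultraproduct of the values of
    the ground atoms under a free ultrafilter.  Its values on the countably many
    ground atoms are mapped into [V] by a map which preserves order, 0 and 1 and
    sends everything below 1 below some [c < 1]: if [V] is finite the values
    have limits in [V]; if [V] is uncountable, every countable linear order
    embeds into [V] below some [c < 1].  As quantifier-free values depend only
    on the order of the atoms, the resulting Herbrand model gives every instance
    a value at most [c], hence so it does to [A]; the uniform bound is what the
    suprema of the existential quantifiers require. *)

(** * Countable unions and course-of-values recursion *)

Lemma countable_setU T (A B : set T) : countable A -> countable B -> countable (A `|` B).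
Proof.
by move=> cA cB; rewrite -bigcup2E; apply: bigcup_countable => // -[|[|i]] _ /=.
Qed.

Section History.
Context (T : Type) (u0 : T) (f : nat -> (nat -> T) -> T).

(** Course-of-values recursion: [f i] computes the value at [i] from the
    sequence of the previous values, padded with [u0]. *)
Fixpoint history (n : nat) : nat -> T :=
  if n is n'.+1
  then fun i => if i == n' then f n' (history n') else history n' i
  else fun=> u0.

Lemma historyE n i : history n i = if (i < n)%N then f i (history i) else u0.
Proof.
elim: n => [//|n IH] /=; rewrite ltnS leq_eqVlt.
by have [->|_] := eqVneq; last exact: IH.
Qed.

End History.

(** * Embedding countable preorders into uncountable sets of reals *)

Section OrderEmbedding.
Context (R : realType) (V : set R).

Definition between (a b : R) : set R := [set x | V x /\ a < x < b].

Lemma uncountable_between_le a b c d : c <= a -> b <= d ->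
  ~ countable (between a b) -> ~ countable (between c d).
Proof.
move=> ca bd; apply: contra_not; apply: sub_countable.
apply: subset_card_le => x [Vx /andP[ax xb]]; split => //.
by rewrite (le_lt_trans ca ax) (lt_le_trans xb bd).
Qed.

(* Apart from the maximum of this set, each of its elements lies in
   [between a q] for a rational q such that [between a q] is countable. *)
Lemma countable_countable_left a :
  countable [set z | V z /\ a < z /\ countable (between a z)].
Proof.
set P := [set z | _].
pose D : set rat := [set q | countable (between a (ratr q))].
pose M := [set z | P z /\ forall z', P z' -> z' <= z].
apply: (@sub_countable _ _ _ (\bigcup_(q in D) between a (ratr q) `|` M)).
  apply: subset_card_le => z [Vz [az cz]].
  have [[z' [Pz' zz']]|nz] := pselect (exists z', P z' /\ z < z').
    left; have [q] := rat_in_itvoo zz'; rewrite in_itv /= => /andP[zq qz'].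
    exists q; last by split => //; rewrite az zq.
    case: Pz' => _ [_]; apply: sub_countable; apply: subset_card_le => x [Vx].
    by move=> /andP[ax xq]; split => //; rewrite ax (lt_trans xq qz').
  right; split=> [//|z' Pz']; rewrite leNgt; apply/negP => zz'.
  by apply: nz; exists z'.
apply: countable_setU.
- exact: bigcup_countable.
- have [[z Mz]|nM] := pselect (exists z, M z).
    apply: sub_countable (countable1 z); apply: subset_card_le => y My /=.
    by apply/eqP; rewrite eq_le (proj2 My) ?(proj2 Mz) //; case: My; case: Mz.
  by rewrite (_ : M = set0) // -subset0 => z Mz; apply: nM; exists z.
Qed.

End OrderEmbedding.

(** Otherwise each point of the interval has countably many points of [V] on its left or on its
    right. The previous lemma makes the first kind countable, and applied to the reflection [W] of
    [V] it does the same for the second. *)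
Lemma uncountable_split (R : realType) (V : set R) a b : ~ countable (between V a b) ->
  exists z, [/\ V z, ~ countable (between V a z) & ~ countable (between V z b)].
Proof.
move=> ncab; apply: contrapT => nz; apply: ncab.
pose W : set R := [set - x | x in V].
have symW c d : between V c d = [set - x | x in between W (- d) (- c)].
  apply/seteqP; split=> [x [Vx /andP[cx xd]]|_ [_ [[x Vx <-]] /andP[h1 h2] <-]].
    exists (- x); rewrite ?opprK //; split; first by exists x.
    by rewrite !ltrN2 cx xd.
  by rewrite opprK; split => //; rewrite -ltrN2 h2 -ltrN2 h1.
pose P := [set z | V z /\ a < z /\ countable (between V a z)].
pose P' := [set z | W z /\ - b < z /\ countable (between W (- b) z)].
apply: (@sub_countable _ _ _ (P `|` [set - x | x in P'])).
  apply: subset_card_le => z [Vz /andP[az zb]].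
  have [c1|n1] := pselect (countable (between V a z)); first by left.
  have [c2|n2] := pselect (countable (between V z b)); last first.
    by exfalso; apply: nz; exists z.
  right; exists (- z); rewrite ?opprK //; split; first by exists z.
  rewrite ltrN2 zb; split => //.
  have -> : between W (- b) (- z) = [set - x | x in between V z b].
    by rewrite symW image_comp -[LHS]image_id; apply: eq_imagel => x _ /=; rewrite opprK.
  exact: sub_countable (card_image_le _ _) c2.
apply: countable_setU.
- exact: countable_countable_left.
- exact: sub_countable (card_image_le _ _) (countable_countable_left _ _).
Qed.

Lemma uncountable_between_lt (R : realType) (V : set R) a b :
  ~ countable (between V a b) -> a < b.
Proof.
move=> nc; rewrite ltNge; apply/negP => ba; apply: nc.
rewrite (_ : between V a b = set0) // -subset0 => x [_ /andP[ax xb]].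
by have := lt_le_trans (lt_trans ax xb) ba; rewrite ltxx.
Qed.

(* Forth construction: the intervals between the values chosen so far are kept
   uncountable, so that they can always be split again. *)
Lemma countable_preorder_embedding (R : realType) (V : set R) a b (le : rel nat) :
  ~ countable (between V a b) -> total le -> transitive le ->
  exists h : nat -> R, (forall i, between V a b (h i)) /\
    forall i j, le i j = (h i <= h j).
Proof.
move=> ncab le_total le_trans.
(* Strictly ordered indices get values with an uncountable gap; equivalent ones get equal values by
   the second clause used both ways. *)
pose inv n (h : nat -> R) :=
  (forall i, (i < n)%N -> [/\ V (h i), ~ countable (between V a (h i)) &
      ~ countable (between V (h i) b)]) /\
  (forall i j, (i < n)%N -> (j < n)%N ->
      (~~ le j i -> ~ countable (between V (h i) (h j))) /\
      (le i j -> h i <= h j)).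
have ext n h z : inv n h ->
    [/\ V z, ~ countable (between V a z) & ~ countable (between V z b)] ->
    (forall i, (i < n)%N ->
      [/\ ~~ le n i -> ~ countable (between V (h i) z),
          ~~ le i n -> ~ countable (between V z (h i)),
          le i n -> h i <= z & le n i -> z <= h i]) ->
    inv n.+1 (fun i => if i == n then z else h i).
  move=> [inv1 inv2] zP hz; split=> [i|i j]; rewrite !ltnS.
    rewrite leq_eqVlt; have [//|_ /= /inv1] := eqVneq i n; exact.
  rewrite (leq_eqVlt i) (leq_eqVlt j); have [->|_] := eqVneq i n; have [->|_] := eqVneq j n => //=.
  - by move=> _ _; split=> [|_]; [have := le_total n n; rewrite orbb => ->|exact: lexx].
  - by move=> _ /hz[].
  - by move=> /hz[].
  - exact: inv2.
have step n h : exists z, inv n h -> inv n.+1 (fun i => if i == n then z else h i).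
  have [invh|ninv] := pselect (inv n h); last by exists a.
  suff [z z1 z2] : exists2 z,
    [/\ V z, ~ countable (between V a z) & ~ countable (between V z b)] &
    forall i, (i < n)%N ->
      [/\ ~~ le n i -> ~ countable (between V (h i) z),
          ~~ le i n -> ~ countable (between V z (h i)),
          le i n -> h i <= z & le n i -> z <= h i].
    by exists z => _; exact: ext.
  have [inv1 inv2] := invh.
  (* An earlier index equivalent to [n] passes on its value. *)
  have [[k [kn lekn lenk]]|nk] := pselect (exists k, [/\ (k < n)%N, le k n & le n k]).
    exists (h k); first exact: inv1.
    move=> i iltn; split.
    - by move=> nlei; apply: (inv2 i k iltn kn).1; apply: contra nlei; exact: le_trans lenk.
    - move=> nlei; apply: (inv2 k i kn iltn).1; apply: contra nlei => /le_trans; exact.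
    - by move=> lein; apply: (inv2 i k iltn kn).2; exact: le_trans lein lenk.
    - by move=> leni; apply: (inv2 k i kn iltn).2; exact: le_trans lekn leni.
  (* By totality [~~ le n i] says that [i] is strictly below [n], so the new value has to lie
     between [lo] and [hi]. *)
  pose lo := \big[Num.max/a]_(i < n | ~~ le n i) h i.
  pose hi := \big[Num.min/b]_(i < n | ~~ le i n) h i.
  have loP : lo = a \/ exists i : 'I_n, ~~ le n i /\ lo = h i.
    rewrite /lo; elim/big_rec: _ => [|i x Pi IH]; first by left.
    by case: leP => _ //; right; exists i.
  have hiP : hi = b \/ exists i : 'I_n, ~~ le i n /\ hi = h i.
    rewrite /hi; elim/big_rec: _ => [|i x Pi IH]; first by left.
    by case: leP => _ //; right; exists i.
  have alo : a <= lo by exact: bigmax_ge_id.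
  have hib : hi <= b by exact: bigmin_le_id.
  have hlo i : (i < n)%N -> ~~ le n i -> h i <= lo.
    by move=> iltn nl; exact: (le_bigmax_cond _ (fun i : 'I_n => h i) (j := Ordinal iltn)).
  have hhi i : (i < n)%N -> ~~ le i n -> hi <= h i.
    by move=> iltn nl; exact: (bigmin_le_cond _ (fun i : 'I_n => h i) (j := Ordinal iltn)).
  (* [lo] and [hi] are end points or chosen values; in each case the invariant provides the gap. *)
  have /uncountable_split[z [Vz nlz nzh]] : ~ countable (between V lo hi).
    case: loP => [->|[i [nlei ->]]]; case: hiP => [->|[j [nlej ->]]] //.
    - by have [] := inv1 j (ltn_ord j).
    - by have [] := inv1 i (ltn_ord i).
    - apply: (inv2 i j (ltn_ord i) (ltn_ord j)).1; apply: contra nlej => leji.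
      have := le_total i n; rewrite (negbTE nlei) orbF => lein.
      exact: le_trans leji lein.
  have loz := uncountable_between_lt nlz; have zhi := uncountable_between_lt nzh.
  exists z; first by split => //; [exact: uncountable_between_le nlz|exact: uncountable_between_le nzh].
  move=> i iltn; split.
  - by move=> /(hlo _ iltn) hilo; exact: uncountable_between_le nlz.
  - by move=> /(hhi _ iltn) hihi; exact: uncountable_between_le nzh.
  - move=> lein; apply/ltW; apply: le_lt_trans loz; apply: hlo => //.
    by apply/negP => leni; apply: nk; exists i.
  - move=> leni; apply/ltW; apply: (lt_le_trans zhi); apply: hhi => //.
    by apply/negP => lein; apply: nk; exists i.
have {step} /choice[f fP] : forall nh : nat * (nat -> R), exists z,
    inv nh.1 nh.2 -> inv nh.1.+1 (fun i => if i == nh.1 then z else nh.2 i).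
  by move=> [n h]; exact: step.
(* The value at [i] is final from stage [i.+1] on, so [h] is the diagonal of the stages. *)
pose g n h := f (n, h); pose h i := history a g i.+1 i.
have invg n : inv n (history a g n).
  by elim: n => [|n IH]; [split=> [[]|[]]|exact: (fP (n, _))].
have hE n i : (i < n)%N -> history a g n i = h i.
  by move=> iltn; rewrite /h !historyE iltn ltnSn.
exists h; split=> [i|i j].
  have [/(_ i (ltnSn i))[Vi nai nib] _] := invg i.+1; split => //.
  by rewrite (uncountable_between_lt nai) (uncountable_between_lt nib).
have [_ inv2] := invg (maxn i j).+1.
have ilt : (i < (maxn i j).+1)%N by rewrite ltnS leq_maxl.
have jlt : (j < (maxn i j).+1)%N by rewrite ltnS leq_maxr.
have [ij leij] := inv2 i j ilt jlt; have [ji leji] := inv2 j i jlt ilt.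
rewrite !hE // in ij leij ji leji.
apply/idP/idP => [//|]; apply: contraTT => /ji /uncountable_between_lt.
by rewrite ltNge.
Qed.

(** * Mapping sequences of truth values, ordered modulo an ultrafilter, into [V] *)

Section Collapse.
Context (R : realType) (T : Type) (U : set_system T) (UU : UltraFilter U).

(** The order of the ultrapower of [R] by [U], on representatives. *)
Definition ule (x y : T -> R) : Prop := U [set N | x N <= y N].

Lemma ule_pointwise x y : (forall N, x N <= y N) -> ule x y.
Proof. by move=> xy; apply: filterS filterT => N _; exact: xy. Qed.

Lemma ule_trans : forall y x z, ule x y -> ule y z -> ule x z.
Proof.
by move=> y x z xy yz; apply: filterS (filterI xy yz) => N [/=]; exact: le_trans.
Qed.

Lemma not_ule x y : ~ ule x y <-> U [set N | y N < x N].
Proof.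
split=> [nxy|yx xy].
  have [//|] := in_ultra_setVsetC [set N | x N <= y N] UU.
  by apply: filterS => N /= /negP; rewrite -ltNge.
have [N [/= xyN]] := filter_ex (filterI xy yx).
by rewrite ltNge xyN.
Qed.

Lemma ule_total x y : ule x y \/ ule y x.
Proof.
have [|/not_ule yx] := pselect (ule x y); first by left.
by right; apply: filterS yx => N; exact: ltW.
Qed.

Lemma ultra_finite_const (A : eqType) (s : seq A) (x : T -> A) :
  U [set N | x N \in s] -> exists2 v, v \in s & U [set N | x N = v].
Proof.
elim: s => [/filter_ex[] //|v s IH] Us.
have [Uv|Unv] := in_ultra_setVsetC [set N | x N = v] UU.
  by exists v; rewrite ?mem_head.
have [|w ws Uw] := IH; last by exists w; rewrite ?inE ?ws ?orbT.
apply: filterS (filterI Us Unv) => N [/=]; rewrite inE => /orP[/eqP|//].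
by [].
Qed.

Lemma collapse_finite (V : set R) : goedel_set V -> finite_set V ->
  exists (c : R) (H : (T -> R) -> R), [/\ c < 1, forall x, V (H x),
    H (cst 0) = 0, H (cst 1) = 1 &
    forall x y, (forall N, V (x N)) -> (forall N, V (y N)) ->
      (ule x y <-> H x <= H y) /\ (~ ule (cst 1) x -> H x <= c)].
Proof.
move=> [_ _ V0 V1] /finite_seqP[s Vs].
have {Vs}memV v : V v <-> v \in s by rewrite Vs.
(* [H x] is the value that [x] takes on a set of [U]; the witness 0 serves sequences that leave
   [V]. *)
have /choice[H HP] x : exists v, V v /\ ((forall N, V (x N)) -> U [set N | x N = v]).
  have [Vx|nVx] := pselect (forall N, V (x N)); last by exists 0.
  have [|v vs Uv] := @ultra_finite_const _ s x; last by exists v; split; [exact/memV|].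
  by apply: filterS filterT => N _; exact/memV.
have Hcst v : V v -> H (cst v) = v.
  by move=> Vv; have [_ /(_ (fun=> Vv))/filter_ex[]] := HP (cst v).
(* The greatest element of [V] below 1. *)
pose c := \big[Num.max/0]_(v <- s | v < 1) v.
have cP v : V v -> v < 1 -> v <= c.
  by move=> /memV vs v1; exact: (bigmax_sup_seq _ v).
exists c, H; split.
- by rewrite /c; elim/big_ind: _ => // x y x1 y1; rewrite gt_max x1 y1.
- by move=> x; have [] := HP x.
- exact: Hcst.
- exact: Hcst.
move=> x y Vx Vy; have [VHx /(_ Vx) Ux] := HP x; have [VHy /(_ Vy) Uy] := HP y.
split; first split=> [xy|Hxy].
- by have [N [/= xyN [<- <-]]] := filter_ex (filterI xy (filterI Ux Uy)).
- by apply: filterS (filterI Ux Uy) => N [/= -> ->].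
- move=> /not_ule Ux1; apply: cP => //.
  by have [N [/= x1 <-]] := filter_ex (filterI Ux1 Ux).
Qed.

(** Modulo [U] the countable set [S] is totally preordered, hence embeds into [V] strictly between 0
    and some [c < 1]; the classes of the constants 0 and 1 are sent to 0 and 1 instead. *)
Lemma collapse_uncountable (V : set R) (S : set (T -> R)) :
  goedel_set V -> ~ countable V -> countable S ->
  exists (c : R) (H : (T -> R) -> R), [/\ c < 1, forall x, V (H x),
    H (cst 0) = 0, H (cst 1) = 1 &
    forall x y, S x -> (forall N, V (x N)) -> S y -> (forall N, V (y N)) ->
      (ule x y <-> H x <= H y) /\ (~ ule (cst 1) x -> H x <= c)].
Proof.
move=> [_ V01 V0 V1] ncV cS.
have {ncV} : ~ countable (between V 0 1).
  apply: contra_not ncV => cV.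
  apply: (@sub_countable _ _ _ (between V 0 1 `|` [set` [:: 0; 1]])).
    apply: subset_card_le => v Vv; have /= := V01 _ Vv.
    rewrite in_itv /= !le_eqVlt => /andP[/predU1P[<-|v0] /predU1P[v1|v1]].
    - by right; rewrite mem_head.
    - by right; rewrite mem_head.
    - by right; rewrite v1 /= inE inE eqxx orbT.
    - by left; split => //; rewrite v0 v1.
  apply: countable_setU => //.
  exact: finite_set_countable (finite_seq _).
move=> /uncountable_split[c [_ nc0c /uncountable_between_lt c1]].
have /pcard_surjP[a aS] := cS.
(* Outside [S] the index is arbitrary, but [h] still takes it into [V]. *)
have /choice[idx idxP] x : exists i, S x -> a i = x.
  have [/aS[i _ <-]|nS] := pselect (S x); first by exists i.
  by exists 0%N.
pose le : rel nat := fun i j => `[< ule (a i) (a j) >].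
have [||h [hV hle]] := countable_preorder_embedding (le := le) nc0c.
- by move=> i j; apply/orP; have [/asboolP|/asboolP] := ule_total (a i) (a j); [left|right].
- by move=> j i k /asboolP ij /asboolP jk; apply/asboolP; exact: ule_trans ij jk.
pose H x := if `[< ule x (cst 0) >] then 0
            else if `[< ule (cst 1) x >] then 1 else h (idx x).
have H01 x : 0 <= H x <= 1.
  rewrite /H; case: asboolP => _; first by rewrite lexx ler01.
  case: asboolP => _; first by rewrite lexx ler01.
  have [_ /andP[h0 hc]] := hV (idx x).
  by rewrite (ltW h0) (ltW (lt_trans hc c1)).
have n10 : ~ ule (cst 1) (cst 0).
  by apply/not_ule; apply: filterS filterT => N _ /=; exact: ltr01.
exists c, H; split=> //.
- rewrite /H => x; case: asboolP => // _; case: asboolP => // _.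
  by case: (hV (idx x)).
- by rewrite /H; case: asboolP => // -[]; exact: ule_pointwise.
- by rewrite /H; case: asboolP => // _; case: asboolP => // -[]; exact: ule_pointwise.
move=> x y Sx Vx Sy Vy.
have le0 z : (forall N, V (z N)) -> ule (cst 0) z.
  by move=> Vz; apply: ule_pointwise => N; have /= := V01 _ (Vz N); rewrite in_itv => /andP[].
have le1 z : (forall N, V (z N)) -> ule z (cst 1).
  by move=> Vz; apply: ule_pointwise => N; have /= := V01 _ (Vz N); rewrite in_itv => /andP[].
have hlt z : h z < 1 by have [_ /andP[_ hc]] := hV z; exact: lt_trans hc c1.
have hgt z : 0 < h z by have [_ /andP[]] := hV z.
split; last first.
  move=> nx1; rewrite /H; case: asboolP => _.
    exact/ltW/(uncountable_between_lt nc0c).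
  by case: asboolP => // _; have [_ /andP[_ /ltW]] := hV (idx x).
rewrite {1}/H; case: asboolP => x0.
  by split=> _; [case/andP: (H01 y)|apply: ule_trans (le0 y Vy)].
case: asboolP => x1.
  split=> [xy|].
    have y1 := ule_trans x1 xy; rewrite /H.
    case: asboolP => y0; first by case: n10; exact: ule_trans y1 y0.
    by case: asboolP => // -[].
  rewrite /H; case: asboolP => y0; first by rewrite ler10.
  case: asboolP => y1; first by move=> _; exact: ule_trans (le1 x Vx) y1.
  by rewrite leNgt hlt.
rewrite /H; case: asboolP => y0.
  split=> [xy|]; last by rewrite leNgt hgt.
  by case: x0; exact: ule_trans xy y0.
case: asboolP => y1.
  by split=> _; [exact: ltW|exact: ule_trans (le1 x Vx) y1].
rewrite -hle /le !idxP //.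
by split=> [/asboolP|/asboolP].
Qed.

Lemma collapse (V : set R) (S : set (T -> R)) :
  goedel_set V -> finite_set V \/ ~ countable V -> countable S ->
  exists (c : R) (H : (T -> R) -> R), [/\ c < 1, forall x, V (H x),
    H (cst 0) = 0, H (cst 1) = 1 &
    forall x y, S x -> (forall N, V (x N)) -> S y -> (forall N, V (y N)) ->
      (ule x y <-> H x <= H y) /\ (~ ule (cst 1) x -> H x <= c)].
Proof.
move=> hV [fV|ncV] cS; last exact: collapse_uncountable.
have [c [H [c1 VH H0 H1 HP]]] := collapse_finite hV fV.
by exists c, H; split=> // x y _ Vx _; exact: HP.
Qed.

End Collapse.

(** * Truth values under quantifiers, substitution and disjunction *)

Section Semantics.
Context (R : realType) (V : set R) (hV : goedel_set V) (L : language).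

(** Provides the bounds without which [inf] and [sup] in [R] lack their order properties;
    nonemptiness comes from the universe. *)
Lemma truth_val01 (I : interp V L) n (A : formula L n) (s : 'I_n -> univ I) :
  0 <= truth_val A s <= 1.
Proof.
have [_ V01 _ _] := hV.
elim: A s => {n} /= [n s|n p a s|n A IHA B IHB s|n A IHA B IHB s|n A IHA B IHB s|n A IH s|n A IH s].
- by rewrite lexx ler01.
- by have := V01 _ (pint_V (fun i => term_val s (a i))); rewrite /= in_itv.
- by case: (leP (truth_val A s)) => _; [exact: IHA|exact: IHB].
- by case: (leP (truth_val A s)) => _; [exact: IHB|exact: IHA].
- by case: ifP => _; [rewrite lexx ler01|exact: IHB].
- have [u] := univ_nonempty I; have /andP[_ hu] := IH (extend s u).
  apply/andP; split; first by apply: lb_le_inf => [|_ [w _ <-]];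
    [exists (truth_val A (extend s u)), u|case/andP: (IH (extend s w))].
  apply: le_trans hu; apply: ge_inf; last by exists u.
  by exists 0 => _ [w _ <-]; case/andP: (IH (extend s w)).
- have [u] := univ_nonempty I; have /andP[hu _] := IH (extend s u).
  apply/andP; split; last by apply: ge_sup => [|_ [w _ <-]];
    [exists (truth_val A (extend s u)), u|case/andP: (IH (extend s w))].
  apply: (le_trans hu); apply: ub_le_sup; last by exists u.
  by exists 1 => _ [w _ <-]; case/andP: (IH (extend s w)).
Qed.

Lemma truth_val_neq1 (I : interp V L) n (A : formula L n) (s : 'I_n -> univ I) :
  truth_val A s <> 1 <-> truth_val A s < 1.
Proof.
have /andP[_ le1] := truth_val01 A s.
rewrite lt_neqAle le1 andbT; split; first by move/eqP.
by move/eqP.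
Qed.

Lemma truth_val_All_le (I : interp V L) n (A : formula L n.+1) (s : 'I_n -> univ I) u :
  truth_val (All A) s <= truth_val A (extend s u).
Proof.
apply: ge_inf; last by exists u.
by exists 0 => _ [w _ <-]; case/andP: (truth_val01 A (extend s w)).
Qed.

Lemma truth_val_All_lt1 (I : interp V L) n (A : formula L n.+1) (s : 'I_n -> univ I) :
  truth_val (All A) s < 1 -> exists u, truth_val A (extend s u) < 1.
Proof.
have [u] := univ_nonempty I.
by move=> /inf_lt[|_ [w _ <-]]; [exists (truth_val A (extend s u)), u|exists w].
Qed.

Lemma truth_val_Ex_ge (I : interp V L) n (A : formula L n.+1) (s : 'I_n -> univ I) u :
  truth_val A (extend s u) <= truth_val (Ex A) s.
Proof.
apply: ub_le_sup; last by exists u.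
by exists 1 => _ [w _ <-]; case/andP: (truth_val01 A (extend s w)).
Qed.

Lemma truth_val_Ex_le (I : interp V L) n (A : formula L n.+1) (s : 'I_n -> univ I) c :
  (forall u, truth_val A (extend s u) <= c) -> truth_val (Ex A) s <= c.
Proof.
have [u] := univ_nonempty I => Ac.
by apply: ge_sup => [|_ [w _ <-]//]; exists (truth_val A (extend s u)), u.
Qed.

Lemma term_val_subst_t (I : interp V L) n k (sigma : 'I_n -> term L k)
    (s : 'I_k -> univ I) (t : term L n) :
  term_val s (subst_t sigma t) = term_val (fun i => term_val s (sigma i)) t.
Proof. by elim: t => //= f a IH; congr fint; apply/funext. Qed.

Lemma truth_val_subst (I : interp V L) n k (sigma : 'I_n -> term L k)
    (s : 'I_k -> univ I) (A : formula L n) : qfree A ->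
  truth_val (subst A sigma) s = truth_val A (fun i => term_val s (sigma i)).
Proof.
elim: A k sigma s => {n} //= [n p a|n A IHA B IHB|n A IHA B IHB|n A IHA B IHB] k sigma s.
- by move=> _; congr pint; apply/funext => i; exact: term_val_subst_t.
- by move=> /andP[/IHA -> /IHB ->].
- by move=> /andP[/IHA -> /IHB ->].
- by move=> /andP[/IHA -> /IHB ->].
Qed.

Lemma truth_val_bigor_lt1 (I : interp V L) n (l : seq (formula L n)) (s : 'I_n -> univ I) :
  (truth_val (bigor l) s < 1) = all (fun A => truth_val A s < 1) l.
Proof.
elim: l => [|A [|B l] IH]; first exact: ltr01.
  by rewrite /= andbT.
by rewrite [LHS]/= gt_max IH.
Qed.

End Semantics.

(** * Strategies of the universal player in prenex formulas *)

Lemma extend_lift T n (s : 'I_n -> T) u (i : 'I_n) : extend s u (lift ord_max i) = s i.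
Proof. by rewrite /extend liftK. Qed.

Lemma extend_max T n (s : 'I_n -> T) u : extend s u ord_max = u.
Proof. by rewrite /extend unlift_none. Qed.

Lemma extend_restrict T n (s : 'I_n.+1 -> T) :
  extend (fun i => s (lift ord_max i)) (s ord_max) = s.
Proof.
by apply/funext => i; case: (unliftP ord_max i) => [j|] ->; rewrite ?extend_lift ?extend_max.
Qed.

Section Strategies.
Context (T : Type) (u0 : T).

(** Total sequences give strategies a type that does not depend on the number of variables. *)
Definition pad n (s : 'I_n -> T) (k : nat) : T :=
  if insub k is Some i then s i else u0.

Definition prefix n (s : 'I_n -> T) (i k : nat) : T :=
  if (k < i)%N then pad s k else u0.

Lemma pad_ord n (s : 'I_n -> T) (i : 'I_n) : pad s i = s i.
Proof. by rewrite /pad valK. Qed.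

Lemma prefix_extend n (s : 'I_n -> T) u i : (i <= n)%N ->
  prefix (extend s u) i = prefix s i.
Proof.
move=> ilen; apply/funext => k; rewrite /prefix; case: ltnP => // ki.
have kn := leq_trans ki ilen.
have -> : k = lift ord_max (Ordinal kn) by rewrite lift_max.
by rewrite pad_ord extend_lift lift_max pad_ord.
Qed.

(** A strategy of the universal player chooses the value of [x_i] from the
    values of the preceding variables. *)
Definition consistent n (Q : 'I_n -> quantifier) (G : nat -> (nat -> T) -> T)
    (s : 'I_n -> T) : Prop :=
  forall i, ~~ is_ex (Q i) -> s i = G i (prefix s i).

Lemma consistent_extend n (Q : 'I_n.+1 -> quantifier) G (s : 'I_n -> T) u :
  consistent Q G (extend s u) <->
  consistent (fun i => Q (lift ord_max i)) G s /\
  (~~ is_ex (Q ord_max) -> u = G n (prefix s n)).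
Proof.
split=> [cs|[cs cu] i].
  split=> [i /cs|/cs]; first by rewrite extend_lift lift_max prefix_extend // ltnW.
  by rewrite extend_max prefix_extend.
case: (unliftP ord_max i) => [j|] ->.
  by move=> /cs; rewrite extend_lift lift_max prefix_extend // ltnW.
by rewrite extend_max prefix_extend.
Qed.

End Strategies.

Section Prenex.
Context (R : realType) (V : set R) (hV : goedel_set V) (L : language).
Context (I : interp V L) (u0 : univ I).

(** The innermost quantifier is absorbed into the matrix: the move of [G] bounds an infimum, and a
    bound common to all moves passes to the supremum. *)
Lemma prenex_le n (Q : 'I_n -> quantifier) G (B : formula L n) (s0 : 'I_0 -> univ I) c :
  (forall s, consistent u0 Q G s -> truth_val B s <= c) ->
  truth_val (prenex Q B) s0 <= c.
Proof.
elim: n Q B => [|n IH] Q B Bc /=; first by apply: Bc => -[].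
apply: IH => s cs; case EQ: (Q ord_max) => /=.
- apply: le_trans (truth_val_All_le hV B s (G n (prefix u0 s n))) _.
  by apply: Bc; apply/consistent_extend.
- apply: truth_val_Ex_le => u; apply: Bc; apply/consistent_extend.
  by split=> //; rewrite EQ.
Qed.

(** An infimum below 1 has an instance below 1, which becomes the move; a supremum below 1 keeps all
    its instances below 1. *)
Lemma prenex_lt1 n (Q : 'I_n -> quantifier) (B : formula L n) (s0 : 'I_0 -> univ I) :
  truth_val (prenex Q B) s0 < 1 ->
  exists G, forall s, consistent u0 Q G s -> truth_val B s < 1.
Proof.
elim: n Q B => [|n IH] Q B /=.
  move=> Bs0; exists (fun _ _ => u0) => s _.
  by rewrite (_ : s = s0) //; apply/funext => -[].
move=> /IH[G]; case EQ: (Q ord_max) => /= GP; last first.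
  exists G => s; rewrite -(extend_restrict s) => /consistent_extend[/GP Es _].
  exact: le_lt_trans (truth_val_Ex_ge hV _ _ _) Es.
have /choice[g gP] (s : 'I_n -> univ I) : exists u,
    truth_val (All B) s < 1 -> truth_val B (extend s u) < 1.
  have [/truth_val_All_lt1[u Bu]|nlt] := pselect (truth_val (All B) s < 1).
    by exists u.
  by exists u0.
(* Position [n] belongs to the quantifier just treated; all other moves are those of [G]. *)
exists (fun (k : nat) (h : nat -> univ I) => if k == n then g (fun i : 'I_n => h i) else G k h) => s.
rewrite -(extend_restrict s) => /consistent_extend[cs cmax].
rewrite cmax ?EQ // eqxx.
set s' := fun i => s (lift ord_max i).
have -> : (fun i : 'I_n => prefix u0 s' n i) = s'.
  by apply/funext => i; rewrite /prefix ltn_ord pad_ord.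
apply: gP; apply: GP => i /cs.
by rewrite ltn_eqF.
Qed.

End Prenex.

Lemma qfree_subst L n k (sigma : 'I_n -> term L k) (A : formula L n) :
  qfree (subst A sigma) = qfree A.
Proof.
by elim: A k sigma => {n} //= n A IHA B IHB k sigma; rewrite IHA IHB.
Qed.

(** * Skolem functions and strategies *)

Section HerbrandForm.
Context (L : language) (n : nat) (Q : 'I_n -> quantifier).

Lemma qfree_emb k (A : formula L k) : qfree (emb Q A) = qfree A.
Proof. by elim: A => {k} //= k A -> B ->. Qed.

Lemma qfree_herbrand_matrix (B : formula L n) : qfree (herbrand_matrix Q B) = qfree B.
Proof. by rewrite qfree_subst qfree_emb. Qed.

Lemma exrank_ltn (i j : 'I_n) : i \in exvars Q -> (i < j)%N -> (exrank Q i < exrank Q j)%N.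
Proof.
move=> iE ij; apply/proper_card/properP; split.
  by apply/fintype.subsetP => k; rewrite !inE => /andP[-> /ltn_trans]; exact.
by exists i; rewrite inE ?ltnn ?andbF // iE.
Qed.

Lemma exrank_leq (i j : 'I_n) : (i <= j)%N -> (exrank Q i <= exrank Q j)%N.
Proof.
move=> ij; apply/subset_leq_card/fintype.subsetP => k; rewrite !inE.
by move=> /andP[-> /leq_trans]; exact.
Qed.

Lemma exrank_inj : {in exvars Q &, injective (exrank Q)}.
Proof.
move=> i j iE jE eij; apply/val_inj => /=.
by case: (ltngtP i j) => // [/(exrank_ltn iE)|/(exrank_ltn jE)]; rewrite eij ltnn.
Qed.

Section Values.
Context (R : realType) (V : set R).

Section Reduct.
Context (J : interp V (hlang L Q)) (u0 : univ J).

Definition reduct : interp V L :=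
  @Interp R V L (univ J) (univ_nonempty J)
    (fun f => @fint _ _ _ J (Orig n f)) (@pint _ _ _ J) (@pint_V _ _ _ J).

Lemma term_val_emb k (t : term L k) (s : 'I_k -> univ J) :
  term_val s (emb_t Q t) = term_val (I := reduct) s t.
Proof. by elim: t => //= f a IH; congr fint; apply/funext. Qed.

Lemma truth_val_emb k (A : formula L k) (s : 'I_k -> univ J) : qfree A ->
  truth_val (emb Q A) s = truth_val (I := reduct) A s.
Proof.
elim: A s => {k} //= [k p a s _|k A IHA B IHB s|k A IHA B IHB s|k A IHA B IHB s].
- by congr pint; apply/funext => i; exact: term_val_emb.
- by move=> /andP[/IHA -> /IHB ->].
- by move=> /andP[/IHA -> /IHB ->].
- by move=> /andP[/IHA -> /IHB ->].
Qed.

Lemma truth_val_herbrand_matrix (B : formula L n) (x : 'I_#|exvars Q| -> univ J) :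
  qfree B -> truth_val (herbrand_matrix Q B) x =
             truth_val (I := reduct) B (fun i => term_val x (hterm L Q i)).
Proof.
by move=> qB; rewrite truth_val_subst ?qfree_emb // truth_val_emb.
Qed.

Lemma term_val_hterm (x : 'I_#|exvars Q| -> univ J) (i : 'I_n) :
  term_val x (hterm L Q i) =
  if i \in exvars Q then pad u0 x (exrank Q i)
  else fint (L := hlang L Q) (f := Skolem L i) (fun l : 'I_(exrank Q i) => pad u0 x l).
Proof.
rewrite /hterm.
(* The boolean index of [boolP] is generalised, so that the dependent match can be destructed. *)
suff aux c (p : alt_spec (i \in exvars Q) (i \in exvars Q) c) :
    term_val x (match p with
      | AltTrue iE => Var (Ordinal (exrank_lt iE))
      | AltFalse _ => @App (hlang L Q) _ (Skolem L i)
          (fun l => Var (widen_ord (exrank_le Q i) l))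
      end) =
    if c then pad u0 x (exrank Q i)
    else fint (L := hlang L Q) (f := Skolem L i) (fun l : 'I_(exrank Q i) => pad u0 x l).
  exact: aux.
case: p => /= iE; first by rewrite -(pad_ord u0 x).
by congr fint; apply/funext => l /=; rewrite -(pad_ord u0 x).
Qed.

(* Strategies read a history of all the variables, Skolem functions only the
   existential ones: the [l]-th of these is looked up by its rank. *)
Let exvalue (h : nat -> univ J) (l : nat) : univ J :=
  if [pick j | (j \in exvars Q) && (exrank Q j == l)] is Some j then h j else u0.

(** The Skolem functions of [J] form a strategy, and along a play consistent with it the matrix
    takes the value of [B^F] at the existential moves. *)
Lemma prenex_le_herbrand (hV : goedel_set V) (B : formula L n) (s0 : 'I_0 -> univ J) c :
  qfree B -> (forall x, truth_val (I := J) (herbrand_matrix Q B) x <= c) ->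
  truth_val (I := reduct) (prenex Q B) s0 <= c.
Proof.
move=> qB Bc.
pose G i h := if insub i is Some j then
  fint (L := hlang L Q) (f := Skolem L j) (fun l : 'I_(exrank Q j) => exvalue h l) else u0.
apply: (@prenex_le _ _ hV _ reduct u0 _ _ G) => s cs.
have := Bc (fun l => exvalue (pad u0 s) l); rewrite truth_val_herbrand_matrix //.
congr (truth_val _ _ <= c); apply/funext => i; rewrite term_val_hterm.
case: ifPn => iE.
  rewrite /pad insubT ?exrank_lt // => rlt /=.
  rewrite /exvalue; case: pickP => [j /andP[jE /eqP ji]|/(_ i)]; last by rewrite iE eqxx.
  by rewrite (exrank_inj jE iE ji) valK.
rewrite cs; last by move: iE; rewrite inE.
rewrite /G valK /=; congr fint; apply/funext => l.
rewrite (pad_ord u0 _ (widen_ord (exrank_le Q i) l)) /exvalue /=.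
(* An existential variable of rank below [exrank Q i] precedes [x_i], so truncation to the prefix
   keeps its value. *)
case: pickP => // j /andP[jE /eqP jl].
rewrite /prefix ifT // ltnNge; apply/negP => /exrank_leq.
by rewrite jl leqNgt ltn_ord.
Qed.

End Reduct.

Section Expansion.
Context (I : interp V L) (u0 : univ I).
Context (sk : forall i : 'I_n, ('I_(exrank Q i) -> univ I) -> univ I).

Definition expansion : interp V (hlang L Q) :=
  @Interp R V (hlang L Q) (univ I) (univ_nonempty I)
    (fun f => match f return ('I_(hfar Q f) -> univ I) -> univ I with
              | Orig f => @fint _ _ _ I f
              | Skolem i => @sk i
              | _ => fun=> u0
              end) (@pint _ _ _ I) (@pint_V _ _ _ I).

End Expansion.

(** Once [I] is destructed, the reduct of its expansion is convertible to it. *)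
Lemma truth_val_expansion (I : interp V L) u0 sk k (A : formula L k) (s : 'I_k -> univ I) :
  truth_val (I := reduct (expansion u0 sk)) A s = truth_val (I := I) A s.
Proof. by case: I u0 sk s. Qed.

(** The Skolem function of [x_i] replays the game: its arguments are the earlier existential moves,
    [G] supplies the universal ones, and the result is the move of [G] at [i]. *)
Lemma prenex_lt1_herbrand (hV : goedel_set V) (I : interp V L) (B : formula L n)
    (s0 : 'I_0 -> univ I) :
  qfree B -> truth_val (prenex Q B) s0 < 1 ->
  exists J : interp V (hlang L Q), forall x, truth_val (I := J) (herbrand_matrix Q B) x < 1.
Proof.
move=> qB; have [u0] := univ_nonempty I.
move=> /(prenex_lt1 hV u0)[G GP].
pose f (x : nat -> univ I) i h := if insub i is Some j then
  if j \in exvars Q then x (exrank Q j) else G i h else u0.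
(* The play before [x_i] reads only existential values of rank below [exrank Q i], the arguments of
   the Skolem function. *)
have f_local (i : 'I_n) (x y : nat -> univ I) : (forall l, (l < exrank Q i)%N -> x l = y l) ->
    history u0 (f x) i = history u0 (f y) i.
  move=> xy; suff H k : (k <= i)%N -> history u0 (f x) k = history u0 (f y) k by exact: H.
  elim: k => // k IH ki; have {}IH := IH (ltnW ki).
  apply/funext => j /=; rewrite IH; case: ifP => // _.
  rewrite /f; case: insubP => // k' _ kk'; case: ifP => // k'E.
  by apply: xy; apply: exrank_ltn => //; rewrite kk'.
pose sk (i : 'I_n) (y : 'I_(exrank Q i) -> univ I) := G i (history u0 (f (pad u0 y)) i).
exists (expansion u0 sk) => x; rewrite truth_val_herbrand_matrix //.
rewrite truth_val_expansion.
pose s (i : 'I_n) := history u0 (f (pad u0 x)) i.+1 i.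
have -> : (fun i => term_val x (hterm L Q i)) = s.
  apply/funext => i; rewrite (term_val_hterm (u0 : univ (expansion u0 sk))).
  rewrite /s historyE ltnSn /f valK; case: ifP => //= _.
  rewrite /sk; congr G; apply: f_local => l lr.
  by rewrite (pad_ord u0 _ (Ordinal lr)).
apply: GP => i iA; rewrite {1}/s historyE ltnSn {1}/f valK inE (negbTE iA).
(* [history] and [prefix] are padded with the same [u0] from [i] on. *)
congr G; apply/funext => k; rewrite /prefix historyE; case: ltnP => // ki.
have kn := ltn_trans ki (ltn_ord i).
by rewrite (pad_ord u0 s (Ordinal kn)) /s historyE ltnSn.
Qed.

End Values.
End HerbrandForm.

(** * Countability of occurring symbols and of ground terms *)

Lemma countable_tuples T k (S : set T) : countable S ->
  countable [set a : 'I_k -> T | forall i, S (a i)].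
Proof.
move=> /countable_injP[f finj]; apply/countable_injP.
exists (fun a => choice.pickle [ffun i => f (a i)]) => a b.
rewrite !inE /= => Sa Sb /(pcan_inj choice.pickleK)/ffunP ab; apply/funext => i.
by apply: finj; rewrite ?inE //; have := ab i; rewrite !ffunE.
Qed.

Section Symbols.
Context (L : language).

(** The language may be uncountable; restricting to occurring predicates keeps the relevant ground
    atoms countable. *)
Fixpoint pred_occurs n (p : pred_sym L) (A : formula L n) : Prop :=
  match A with
  | Bot _ => False
  | Atom _ q _ => q = p
  | And _ A B | Or _ A B | Imp _ A B => pred_occurs p A \/ pred_occurs p B
  | All _ A | Ex _ A => pred_occurs p A
  end.

Lemma countable_occurs_t n (t : term L n) : countable [set f | occurs_t f t].
Proof.
elim: t => [i|f a IH] /=; first by rewrite (_ : [set _ | _] = set0).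
apply: (@sub_countable _ _ _ ([set f] `|` \bigcup_i [set g | occurs_t g (a i)])).
  by apply: subset_card_le => g [fg|[i ?]]; [left; exact: esym|right; exists i].
by apply: countable_setU; [exact: countable1|exact: bigcup_countable].
Qed.

Lemma countable_occurs n (A : formula L n) : countable [set f | occurs f A].
Proof.
elim: A => {n} /= [n|n p a|n A IHA B IHB|n A IHA B IHB|n A IHA B IHB|n A //|n A //].
- by rewrite (_ : [set _ | _] = set0).
- apply: (@sub_countable _ _ _ (\bigcup_i [set g | occurs_t g (a i)])).
    by apply: subset_card_le => g [i ?]; exists i.
  by apply: bigcup_countable => // i _; exact: countable_occurs_t.
- exact: countable_setU.
- exact: countable_setU.
- exact: countable_setU.
Qed.

Lemma countable_pred_occurs n (A : formula L n) : countable [set p | pred_occurs p A].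
Proof.
elim: A => {n} /= [n|n p a|n A IHA B IHB|n A IHA B IHB|n A IHA B IHB|n A //|n A //].
- by rewrite (_ : [set _ | _] = set0).
- by apply: sub_countable (countable1 p); apply: subset_card_le => q ->.
- exact: countable_setU.
- exact: countable_setU.
- exact: countable_setU.
Qed.

End Symbols.

Section GroundTerms.
Context (L : language) (Sy : set (fun_sym L)).

Definition over n (t : term L n) : Prop := forall f, occurs_t f t -> Sy f.

Definition ground : Type := {t : term L 0 | over t}.

Lemma sval_ground_inj : injective (fun t : ground => sval t).
Proof.
move=> [t ot] [u ou] /= tu; rewrite -tu in ou *.
by congr exist; exact: Prop_irrelevance.
Qed.

(** The ground terms of height at most [k], where constants have height 1. *)
Fixpoint stage (k : nat) : set (term L 0) :=
  if k is k'.+1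
  then \bigcup_(f in Sy) [set App f a | a in [set a | forall i, stage k' (a i)]]
  else set0.

Lemma stage_leq k l : (k <= l)%N -> stage k `<=` stage l.
Proof.
elim: k l => [_ _ t []|k IH [//|l] kl t [f Sf [a ha <-]]].
by exists f => //; exists a => // i; exact: IH kl _ (ha i).
Qed.

Lemma over_stage (t : term L 0) : over t -> exists k, stage k t.
Proof.
elim: t => [[] //|f a IH] ot.
have /choice[k kP] i : exists k, stage k (a i).
  by apply: IH => g gi; apply: ot; right; exists i.
exists (\max_i k i).+1; exists f; first by apply: ot; left.
by exists a => // i; apply: stage_leq (kP i); exact: leq_bigmax.
Qed.

Lemma countable_ground : countable Sy -> countable [set: ground].
Proof.
move=> cSy; have cstage k : countable (stage k).
  elim: k => [|k IH] //=; apply: bigcup_countable => // f _.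
  by apply: sub_countable (card_image_le _ _) _; exact: countable_tuples.
have /countable_injP[f finj] : countable [set t : term L 0 | over t].
  apply: (@sub_countable _ _ _ (\bigcup_k stage k)); last exact: bigcup_countable.
  by apply: subset_card_le => t /over_stage[k]; exists k.
apply/countable_injP; exists (fun t => f (sval t)) => t u _ _ ftu.
by apply/sval_ground_inj/finj; rewrite ?inE //; [exact: (svalP t)|exact: (svalP u)].
Qed.

End GroundTerms.

(** * The Herbrand model obtained from an ultraproduct *)

Section HerbrandModel.
Context (R : realType) (V : set R) (hV : goedel_set V).
Context (L : language) (Sy : set (fun_sym L)) (cSy : countable Sy) (g0 : ground Sy).

Lemma over_App f (a : 'I_(fun_ar f) -> ground Sy) :
  Sy f -> over Sy (App f (fun i => sval (a i))).
Proof. by move=> Sf g [<-//|[i]]; exact: (svalP (a i)). Qed.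

Context (T : Type) (U : set_system T) (UU : UltraFilter U).
Context (I : T -> interp V L) (s : forall N, 'I_0 -> univ (I N)).
Context (H : (T -> R) -> R) (VH : forall x, V (H x)).

Definition ev N (t : ground Sy) : univ (I N) := term_val (@s N) (sval t).

Definition atom_seq (p : pred_sym L) (a : 'I_(pred_ar p) -> ground Sy) : T -> R :=
  fun N => pint (fun i => ev N (a i)).

(** Applying a symbol outside [Sy] would leave the universe, so it returns [g0]. *)
Definition herbrand_model : interp V L :=
  @Interp R V L (ground Sy) (inhabits g0)
    (fun f a => if pselect (Sy f) is left Sf then exist _ _ (@over_App f a Sf) else g0)
    (fun p a => H (atom_seq a)) (fun p a => VH _).

Lemma ev_term_val N k (t : term L k) (x : 'I_k -> univ herbrand_model) : over Sy t ->
  ev N (term_val x t) = term_val (fun i => ev N (x i)) t.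
Proof.
elim: t => //= f a IH oa; case: pselect => [Sf|[]]; last by apply: oa; left.
rewrite /ev /=; congr fint; apply/funext => i.
by apply: IH => g gi; apply: oa; right; exists i.
Qed.

(** The candidates for the value of a quantifier-free formula, and the countable set on which [H]
    has to respect the order. *)
Definition value_seqs k (A : formula L k) : set (T -> R) :=
  [set cst 0; cst 1] `|`
  \bigcup_(p in [set p | pred_occurs p A]) range (@atom_seq p).

Lemma countable_value_seqs k (A : formula L k) : countable (value_seqs A).
Proof.
apply: countable_setU; first by apply: countable_setU; exact: countable1.
apply: bigcup_countable; first exact: countable_pred_occurs.
move=> p _; apply: sub_countable (card_image_le _ _) _.
apply: sub_countable _ (countable_tuples _ (countable_ground cSy)).
by apply: subset_card_le => a _ i.
Qed.

Hypothesis (H0 : H (cst 0) = 0) (H1 : H (cst 1) = 1).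

(* The value of a quantifier-free formula is the value of one of its atoms, 0 or
   1, and which one depends only on the order of these values; hence the same
   atom works for almost all [I N] and for the Herbrand model. *)
Lemma truth_val_herbrand_model k (A : formula L k) (x : 'I_k -> univ herbrand_model) S :
  qfree A -> (forall f, occurs f A -> Sy f) -> value_seqs A `<=` S ->
  (forall y z, S y -> (forall N, V (y N)) -> S z -> (forall N, V (z N)) ->
     (ule U y z <-> H y <= H z)) ->
  exists y, [/\ S y, forall N, V (y N), truth_val A x = H y &
    U [set N | truth_val A (fun i => ev N (x i)) = y N]].
Proof.
move=> qA oA AS SH; have [_ _ V0 V1] := hV.
have S0 : S (cst 0) by apply: AS; do 2!left.
have S1 : S (cst 1) by apply: AS; left; right.
(* In this form the inclusion passes to subformulas while [S] stays fixed. *)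
have {AS} : forall p, pred_occurs p A -> range (@atom_seq p) `<=` S.
  by move=> p pA y py; apply: AS; right; exists p.
elim: A x qA oA => {k} //= [k|k p a|k A IHA B IHB|k A IHA B IHB|k A IHA B IHB] x.
- by move=> _ _ _; exists (cst 0); split => //; exact: filterS filterT.
- move=> _ oa /(_ _ erefl) pS; exists (atom_seq (fun i => term_val (I := herbrand_model) x (a i))); split => //.
  + by apply: pS; exists (fun i => term_val (I := herbrand_model) x (a i)).
  + by move=> N; exact: pint_V.
  + apply: filterS filterT => N _ /=; congr pint; apply/funext => i.
    by rewrite ev_term_val // => f fi; apply: oa; exists i.
all: move=> /andP[qA qB] oAB pAB.
all: have {IHA}[|p pA|y [Sy' Vy -> Uy]] := IHA x qA; [by auto|by apply: pAB; left|].
all: have {IHB}[|p pB|z [Sz Vz -> Uz]] := IHB x qB; [by auto|by apply: pAB; right|].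
(* The order of the two sequences modulo [U] decides the connective, and [H] agrees with it. *)
all: have [yz|/(not_ule UU) zy] := pselect (ule U y z).
- exists y; split => //; first by move/(SH _ _ Sy' Vy Sz Vz): yz => /min_idPl.
  by apply: filterS (filterI yz (filterI Uy Uz)) => N [/= yzN [-> ->]]; exact/min_idPl.
- exists z; split => //.
    by apply/min_idPr/(SH _ _ Sz Vz Sy' Vy); apply: filterS zy => N /ltW.
  by apply: filterS (filterI zy (filterI Uy Uz)) => N [/= /ltW zyN [-> ->]]; exact/min_idPr.
- exists z; split => //; first by move/(SH _ _ Sy' Vy Sz Vz): yz => /max_idPr.
  by apply: filterS (filterI yz (filterI Uy Uz)) => N [/= yzN [-> ->]]; exact/max_idPr.
- exists y; split => //.
    by apply/max_idPl/(SH _ _ Sz Vz Sy' Vy); apply: filterS zy => N /ltW.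
  by apply: filterS (filterI zy (filterI Uy Uz)) => N [/= /ltW zyN [-> ->]]; exact/max_idPl.
- exists (cst 1); split => //; first by move/(SH _ _ Sy' Vy Sz Vz): yz => ->.
  by apply: filterS (filterI yz (filterI Uy Uz)) => N [/= yz' [-> ->]]; rewrite yz'.
- exists z; split => //.
    case: ifP => // /(SH _ _ Sy' Vy Sz Vz) yz.
    by move/(not_ule UU): zy => /(_ yz).
  apply: filterS (filterI zy (filterI Uy Uz)) => N [/= zy' [-> ->]].
  by rewrite leNgt zy'.
Qed.

End HerbrandModel.

(** * Compactness and the equivalence *)

Lemma herbrand_compactness (R : realType) (V : set R) (hV : goedel_set V)
    (hfu : finite_set V \/ ~ countable V) (L : language) (Sy : set (fun_sym L))
    k (A : formula L k) :
  countable Sy -> (exists2 f, Sy f & fun_ar f = 0%N) ->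
  qfree A -> (forall f, occurs f A -> Sy f) ->
  (forall m (t : 'I_m -> 'I_k -> term L 0), (forall i j, over Sy (t i j)) ->
     ~ valid V (bigor [seq subst A (t i) | i <- enum 'I_m])) ->
  exists (c : R) (J : interp V L), c < 1 /\ forall x, truth_val (I := J) A x <= c.
Proof.
move=> cSy [f0 Sf0 f00] qA oA nvalid.
have noarg : 'I_(fun_ar f0) -> False by rewrite f00 => -[].
have g0 : ground Sy.
  exists (App f0 (fun i => False_rect _ (noarg i))) => f [<-//|[i]]; case: (noarg i).
have /countable_injP[code code_inj] : countable [set a : 'I_k -> ground Sy | forall i, setT (a i)].
  exact: countable_tuples _ (countable_ground cSy).
(* [tau] enumerates the tuples of ground terms, being a left inverse of [code]. *)
have /choice[tau tauP] N : exists x, (exists y, code y = N) -> code x = N.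
  have [[y yN]|nN] := pselect (exists y, code y = N); first by exists y.
  by exists (fun=> g0).
have codeK x : tau (code x) = x.
  by apply: code_inj; rewrite ?inE //; apply: tauP; exists x.
have /choice[Is IsP] N : exists Is : {I : interp V L & 'I_0 -> univ I}, forall i, (i <= N)%N ->
    truth_val (subst A (fun j => sval (tau i j))) (projT2 Is) < 1.
  have := nvalid N.+1 (fun i j => sval (tau i j)) (fun i j => svalP (tau i j)).
  move=> /existsNP[I /existsNP[s /(truth_val_neq1 hV)]].
  rewrite truth_val_bigor_lt1 // all_map => /allP sP; exists (existT _ I s) => i iN.
  exact: (sP (Ordinal (iN : (i < N.+1)%N)) (mem_enum _ _)).
(* [U] contains all cofinal segments, so each instance is refuted by [U]-almost all [I N]. *)
have [U [UU ooU]] := ultraFilterLemma eventually_filter.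
pose I N := projT1 (Is N); pose s N : 'I_0 -> univ (I N) := projT2 (Is N).
have [c [H [c1 VH H0 H1 HP]]] :=
  collapse UU hV hfu (countable_value_seqs cSy s A).
exists c, (herbrand_model g0 s VH); split=> // x.
have [y z Sy' Vy Sz Vz|y [Sy' Vy -> Uy]] :=
  truth_val_herbrand_model hV UU H0 H1 x qA oA (@subset_refl _ (value_seqs Sy s A)).
- by have [] := HP y z Sy' Vy Sz Vz.
(* The instance, equal to [y] almost everywhere, is below 1 there, so [c] bounds [H y]. *)
have [_] := HP y y Sy' Vy Sy' Vy; apply; apply/(not_ule UU).
have Ux : U [set N | (code x <= N)%N] by apply: ooU; exact: nbhs_infty_ge.
apply: filterS (filterI Ux Uy) => N [/= /IsP xN <-].
by move: xN; rewrite codeK truth_val_subst.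
Qed.

Lemma countable_HUsym (L : language) n (Q : 'I_n -> quantifier) k
    (C : formula (hlang L Q) k) : countable (HUsym C).
Proof.
apply: (@sub_countable _ _ _
  ([set f | occurs f C] `|` ([set HConst L n] `|` [set HFun L n]))).
  by apply: subset_card_le => f [?|[-> _]|[-> _]]; [left|right; left|right; right].
apply: countable_setU; first exact: countable_occurs.
by apply: countable_setU; exact: countable1.
Qed.

(** Ensures that there are ground terms at all. *)
Lemma HUsym_constant (L : language) n (Q : 'I_n -> quantifier) k
    (C : formula (hlang L Q) k) : exists2 f, HUsym C f & fun_ar f = 0%N.
Proof.
have [[f fC f0]|nC] := pselect (exists2 g, occurs g C & fun_ar g = 0%N).
  by exists f => //; constructor 1.
by exists (HConst L n) => //; constructor 2.
Qed.

Theorem theorem52 (R : realType) (V : set R) (hV : goedel_set V)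
    (hfu : finite_set V \/ ~ countable V)
    (L : language) (n : nat) (Q : 'I_n -> quantifier) (B : formula L n)
    (hB : qfree B) :
  valid V (prenex Q B) <->
  exists (m : nat) (t : 'I_m -> 'I_#|exvars Q| -> term (hlang L Q) 0),
    (forall i j, HU (herbrand_matrix Q B) (t i j)) /\
    valid V (bigor [seq subst (herbrand_matrix Q B) (t i) | i <- enum 'I_m]).
Proof.
split=> [vA|[m [t [_ vt]]] I s0].
- apply: contrapT => nt.
  have [|m t tHU vt|c [J [c1 Jc]]] := herbrand_compactness hV hfu (countable_HUsym _)
      (HUsym_constant (herbrand_matrix Q B)) _ (fun f => @Or31 _ _ _).
  + by rewrite qfree_herbrand_matrix.
  (* [HU] unfolds to [over] for the symbols [HUsym]. *)
  + by apply: nt; exists m, t.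
  have [u0] := univ_nonempty J; have s0 : 'I_0 -> univ J by case.
  have := prenex_le_herbrand u0 hV s0 hB Jc.
  by rewrite vA leNgt c1.
- apply: contrapT => /(truth_val_neq1 hV) /(prenex_lt1_herbrand hV hB)[J Jlt].
  have [u0] := univ_nonempty J; have s : 'I_0 -> univ J by case.
  have : truth_val (bigor [seq subst (herbrand_matrix Q B) (t i) | i <- enum 'I_m]) s < 1.
    rewrite truth_val_bigor_lt1 all_map; apply/allP => i _ /=.
    by rewrite truth_val_subst ?qfree_herbrand_matrix.
  by rewrite vt ltxx.
Qed.
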